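(* Let $f$ be any honest function. There exists an elementary function $\check{T}:\mathbb{Q}\to\mathbb{Q}$ such that (i) $\check{T}(q)=0$ if $q<\alpha^f$, and (ii) $q>\check{T}(q)>\alpha^f$ if $q>\alpha^f$.
   Context: A function is elementary if it can be generated from $2^x$, $\max$, $0$, successor and projections by composition and bounded primitive recursion; a relation is elementary if its characteristic function is. Rationals are coded into $\mathbb{N}$ in a standard elementary way. A function $f:\mathbb{N}\to\mathbb{N}$ is honest if $f(x)\le f(x+1)$, $f(x)\ge 2^x$ for all $x$, and the relation $f(x)=y$ is elementary. Let $P_i$ be the $i$-th prime ($P_0=2$). Define $g(0)=1$, $g(j+1)=P_j^{2(j+2)(g(j)+1)^3}$, $h(i)=g(f(i)+i)$, $\alpha^f_n=\sum_{i=0}^nP_i^{-h(i)}$ and $\alpha^f=\lim_{n\to\infty}\alpha^f_n$ (an irrational number). *)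

(* Defs.v *)
From mathcomp Require Import all_boot all_order all_algebra.
From mathcomp Require Import zify.
From mathcomp Require Import all_classical all_reals all_analysis.
Set Implicit Arguments.
Unset Strict Implicit.
Unset Printing Implicit Defensive.
Import Order.TTheory GRing.Theory Num.Theory.
Import numFieldNormedType.Exports.

(* The constant 0 is taken with arity 0; [elementary_comp] with [m = 0]
   provides it at every other arity.  In [elementary_brec] the recursion variable
   comes first:
     F(0, x) = G(x),  F(n + 1, x) = H(n, F(n, x), x),  F(n, x) <= J(n, x). *)
Inductive elementary : forall k : nat, (k.-tuple nat -> nat) -> Prop :=
| elementary_exp2 :
    elementary (fun x : 1.-tuple nat => 2 ^ tnth x ord0)
| elementary_max :
    elementary (fun x : 2.-tuple nat => maxn (tnth x ord0) (tnth x ord_max))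
| elementary_zero :
    elementary (fun _ : 0.-tuple nat => 0)
| elementary_succ :
    elementary (fun x : 1.-tuple nat => (tnth x ord0).+1)
| elementary_proj (k : nat) (i : 'I_k) :
    elementary (fun x : k.-tuple nat => tnth x i)
| elementary_comp (k m : nat) (G : m.-tuple nat -> nat)
    (H : 'I_m -> k.-tuple nat -> nat) :
    elementary G -> (forall i, elementary (H i)) ->
    elementary (fun x : k.-tuple nat => G [tuple H i x | i < m])
| elementary_brec (k : nat) (G : k.-tuple nat -> nat)
    (H : k.+2.-tuple nat -> nat) (J F : k.+1.-tuple nat -> nat) :
    elementary G -> elementary H -> elementary J ->
    (forall x : k.-tuple nat, F [tuple of 0 :: x] = G x) ->
    (forall (n : nat) (x : k.-tuple nat),
       F [tuple of n.+1 :: x] = H [tuple of n :: F [tuple of n :: x] :: x]) ->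
    (forall y : k.+1.-tuple nat, F y <= J y) ->
    elementary F.

Definition elementary_rel (k : nat) (P : k.-tuple nat -> bool) : Prop :=
  elementary (fun x : k.-tuple nat => nat_of_bool (P x)).

Definition cantor_pair (a b : nat) : nat := ((a + b) * (a + b).+1)./2 + b.

Definition int_code (z : int) : nat :=
  match z with
  | Posz n => n.*2
  | Negz n => n.*2.+1
  end.

Definition rat_code (q : rat) : nat :=
  cantor_pair (int_code (numq q)) `|denq q|%N.

Lemma cantor_pair_inj (a b c d : nat) :
  cantor_pair a b = cantor_pair c d -> a = c /\ b = d.
Proof.
rewrite /cantor_pair.
have half s : ((s * s.+1)./2).*2 = s * s.+1.
  by rewrite even_halfK // oddM /= andbN.
have := half (a + b); have := half (c + d).
move: ((c + d) * (c + d).+1)./2 ((a + b) * (a + b).+1)./2 => u v.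
rewrite -!muln2 => hu hv e.
by case: (ltngtP (a + b) (c + d)) => lt_s; [nia | nia | rewrite lt_s in hv; lia].
Qed.

Lemma int_code_inj : injective int_code.
Proof. by case=> m [] n /= e; try (exfalso; lia); congr (_ _); lia. Qed.

Lemma rat_code_inj : injective rat_code.
Proof.
move=> p q /cantor_pair_inj[/int_code_inj en ed].
rewrite -[p]divq_num_den -[q]divq_num_den en.
by rewrite -[denq p]absz_denq ed absz_denq.
Qed.

Definition elementary_ratfun (T : rat -> rat) : Prop :=
  exists t : 1.-tuple nat -> nat,
    elementary t /\ forall q : rat, t [tuple rat_code q] = rat_code (T q).

Definition honest (f : nat -> nat) : Prop :=
  [/\ forall x : nat, f x <= f x.+1,
      forall x : nat, 2 ^ x <= f x &
      elementary_rel (fun z : 2.-tuple nat => f (tnth z ord0) == tnth z ord_max)].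

Lemma next_prime_exists (n : nat) : exists p : nat, (n < p) && prime p.
Proof. by have [p np pp] := prime_above n; exists p; rewrite np. Qed.

Definition next_prime (n : nat) : nat := ex_minn (next_prime_exists n).

(* Indexed from 0, so that [nth_prime 0 = 2]. *)
Definition nth_prime (i : nat) : nat := iter i.+1 next_prime 0.

Fixpoint g (j : nat) : nat :=
  match j with
  | 0 => 1
  | i.+1 => (nth_prime i ^ (2 * (i + 2) * (g i + 1) ^ 3))
  end.

Definition h (f : nat -> nat) (i : nat) : nat := g (f i + i).

Local Open Scope ring_scope.

Definition alpha_approx (R : realType) (f : nat -> nat) (n : nat) : R :=
  \sum_(i < n.+1) (nth_prime i)%:R ^- h f i.

Definition alpha (R : realType) (f : nat -> nat) : R :=
  limn (alpha_approx R f).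

(* Main.v *)
Require Import Defs.
From mathcomp Require Import all_boot all_order all_algebra.
From mathcomp Require Import zify ring lra.
From mathcomp Require Import all_classical all_reals all_analysis.
Set Implicit Arguments.
Unset Strict Implicit.
Unset Printing Implicit Defensive.
Import Order.TTheory GRing.Theory Num.Theory.
Import numFieldNormedType.Exports.

(* For a rational q with denominator n, let s = 2n + 4, let A be the sum of the terms
   P_i^(-h(i)) with h(i) <= s, say those with i < c, and let D be its denominator.  As h
   grows so fast that 2(h(0) + ... + h(c-1)) <= h(c), we get 4nD < P_c^h(c).  Hence
   alpha - A <= 2 P_c^(-h(c)) is less than 1/(2nD), whereas q > A forces
   q - A >= 1/(nD); so q <= A implies q < alpha, and q > A implies
   alpha < (A + q)/2 < q.  The function sending q to 0 in the first case and to
   (A + q)/2 in the second is elementary, because only min(h(i), s + 1) is needed: this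
   is computed from the graph of f and from the recursion for g truncated at s + 1. *)

(** * Elementary functions on nested contexts *)

(* A [k]-tuple [x_0 :: x_1 :: ...] is read as the nested pair [((..., x_1), x_0)],
   so that the variable bound last is always [p.2]. *)
Fixpoint ctx (k : nat) : Type := if k is k'.+1 then (ctx k' * nat)%type else unit.

Fixpoint ctx_of_seq (k : nat) (s : seq nat) : ctx k :=
  match k with
  | 0 => tt
  | k'.+1 => (ctx_of_seq k' (behead s), head 0 s)
  end.

Fixpoint seq_of_ctx (k : nat) : ctx k -> seq nat :=
  match k with
  | 0 => fun _ => [::]
  | k'.+1 => fun c => c.2 :: seq_of_ctx c.1
  end.

Fixpoint ctx_nth (k i : nat) : ctx k -> nat :=
  match k with
  | 0 => fun _ => 0
  | k'.+1 => fun c => if i is i'.+1 then ctx_nth i' c.1 else c.2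
  end.

Fixpoint ctx_max (k : nat) : ctx k -> nat :=
  match k with
  | 0 => fun _ => 0
  | k'.+1 => fun c => maxn (ctx_max c.1) c.2
  end.

(** Over contexts a function is an ordinary expression in [p.2], [p.1.2], ..., so its elementarity
    can be proved by following its syntax. *)
Definition el (k : nat) (F : ctx k -> nat) : Prop :=
  elementary (fun x : k.-tuple nat => F (ctx_of_seq k x)).
Arguments el : clear implicits.

Lemma size_seq_of_ctx k (c : ctx k) : size (seq_of_ctx c) == k.
Proof. by elim: k c => //= k IH [c n] /=; rewrite eqSS. Qed.

Lemma seq_of_ctxK k (c : ctx k) : ctx_of_seq k (seq_of_ctx c) = c.
Proof. by elim: k c => [[]|k IH [c n]] //=; rewrite IH. Qed.

Lemma ctx_of_seqK k (s : seq nat) : size s = k -> seq_of_ctx (ctx_of_seq k s) = s.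
Proof. by elim: k s => [|k IH] [|a s] //= [/IH->]. Qed.

Lemma ctx_nthE k i (c : ctx k) : ctx_nth i c = nth 0 (seq_of_ctx c) i.
Proof. by elim: k i c => [|k IH] [|i] c //=. Qed.

Lemma leq_ctx_nth k i (c : ctx k) : ctx_nth i c <= ctx_max c.
Proof.
elim: k i c => [|k IH] [|i] //= [c n] /=; first exact: leq_maxr.
by rewrite leq_max IH.
Qed.

Lemma el_nth k i : i < k -> el k (ctx_nth i).
Proof.
move=> ik; rewrite /el.
rewrite (_ : (fun x => _) = (fun x : k.-tuple nat => tnth x (Ordinal ik))).
  exact: elementary_proj.
apply: funext => x.
by rewrite ctx_nthE ctx_of_seqK ?size_tuple // (tnth_nth 0).
Qed.

Lemma el_comp m k (G : ctx m -> nat) (s : ctx k -> ctx m) :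
  el m G -> (forall i, i < m -> el k (fun x => ctx_nth i (s x))) ->
  el k (fun x => G (s x)).
Proof.
move=> eG es; rewrite /el.
have := @elementary_comp k m _ (fun i x => ctx_nth i (s (ctx_of_seq k x))) eG
  (fun i => es i (ltn_ord i)).
congr elementary; apply: funext => x; congr G.
rewrite -[RHS]seq_of_ctxK; congr ctx_of_seq.
apply: (@eq_from_nth _ 0) => [|i].
  by rewrite size_tuple (eqP (size_seq_of_ctx _)).
rewrite size_tuple => im.
by rewrite -(tnth_nth 0 _ (Ordinal im)) tnth_mktuple ctx_nthE.
Qed.

Lemma el_v0 k : el k.+1 (fun p : ctx k * nat => p.2).
Proof. exact: (@el_nth k.+1 0). Qed.

Lemma el_v1 k : el k.+2 (fun p : ctx k * nat * nat => p.1.2).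
Proof. exact: (@el_nth k.+2 1). Qed.

Lemma el_v2 k : el k.+3 (fun p : ctx k * nat * nat * nat => p.1.1.2).
Proof. exact: (@el_nth k.+3 2). Qed.

Lemma el_v3 k : el k.+4 (fun p : ctx k * nat * nat * nat * nat => p.1.1.1.2).
Proof. exact: (@el_nth k.+4 3). Qed.

Lemma el_weak k (F : ctx k -> nat) :
  el k F -> el k.+1 (fun p : ctx k * nat => F p.1).
Proof.
move=> eF; apply: (@el_comp k k.+1 F fst) => // i ik.
exact: (@el_nth k.+1 i.+1).
Qed.

(** Inserts a dummy variable below the last one. In a recursion step this is the slot of the
    previous value, which the summand or factor ignores. *)
Lemma el_weak1 k (F : ctx k -> nat -> nat) :
  el k.+1 (fun p : ctx k * nat => F p.1 p.2) ->
  el k.+2 (fun p : ctx k * nat * nat => F p.1.1 p.2).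
Proof.
move=> eF; apply: (@el_comp k.+1 k.+2 (fun p : ctx k * nat => F p.1 p.2)
  (fun p : ctx k * nat * nat => (p.1.1, p.2))) => // -[|i] ik.
  exact: (@el_nth k.+2 0).
exact: (@el_nth k.+2 i.+2).
Qed.

Lemma el_subst k (F : ctx k -> nat -> nat) (B : ctx k -> nat) :
  el k.+1 (fun p : ctx k * nat => F p.1 p.2) -> el k B -> el k (fun x => F x (B x)).
Proof.
move=> eF eB; apply: (@el_comp k.+1 k (fun p : ctx k * nat => F p.1 p.2)
  (fun x : ctx k => (x, B x))) => // -[|i] //= ik.
exact: (@el_nth k i).
Qed.

Lemma el_app1 (f : nat -> nat) k (F : ctx k -> nat) :
  el 1 (fun p => f p.2) -> el k F -> el k (fun x => f (F x)).
Proof.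
by move=> ef eF; apply: (@el_comp 1 k (fun p => f p.2) (fun x => (tt, F x))) => // -[].
Qed.

Lemma el_app2 (f : nat -> nat -> nat) k (F G : ctx k -> nat) :
  el 2 (fun p => f p.1.2 p.2) -> el k F -> el k G -> el k (fun x => f (F x) (G x)).
Proof.
move=> ef eF eG; apply: (@el_comp 2 k (fun p => f p.1.2 p.2) (fun x => (tt, F x, G x))) => //.
by case=> [|[|]].
Qed.

Lemma ctx_of_tuple1 (x : 1.-tuple nat) : ctx_of_seq 1 x = (tt, tnth x ord0).
Proof. by case/tupleP: x => a x. Qed.

Lemma ctx_of_tuple2 (x : 2.-tuple nat) :
  ctx_of_seq 2 x = (tt, tnth x ord_max, tnth x ord0).
Proof. by case/tupleP: x => a x; case/tupleP: x => b x. Qed.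

(** * Arithmetic, comparisons and Boolean connectives *)

Lemma el_succ k (F : ctx k -> nat) : el k F -> el k (fun x => (F x).+1).
Proof.
apply: (@el_app1 succn); rewrite /el.
by under eq_fun do rewrite ctx_of_tuple1; exact: elementary_succ.
Qed.

Lemma el_exp2 k (F : ctx k -> nat) : el k F -> el k (fun x => 2 ^ F x).
Proof.
apply: (@el_app1 (expn 2)); rewrite /el.
by under eq_fun do rewrite ctx_of_tuple1; exact: elementary_exp2.
Qed.

Lemma el_maxn k (F G : ctx k -> nat) :
  el k F -> el k G -> el k (fun x => maxn (F x) (G x)).
Proof.
apply: el_app2; rewrite /el.
by under eq_fun do rewrite ctx_of_tuple2 maxnC; exact: elementary_max.
Qed.

Lemma el_const k n : el k (fun=> n).
Proof.
elim: n => [|n IH]; last exact: el_succ.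
have H0 (i : 'I_0) : elementary (fun _ : k.-tuple nat => 0) by case: i.
exact: (elementary_comp elementary_zero H0).
Qed.

(** The tuple [n :: u :: x] is read as [((x, u), n)]: in the step function the counter is [p.2] and
    the previous value is [p.1.2]. *)
Lemma el_brec k (G : ctx k -> nat) (H : ctx k -> nat -> nat -> nat)
    (J F : ctx k -> nat -> nat) :
  el k G -> el k.+2 (fun p : ctx k * nat * nat => H p.1.1 p.2 p.1.2) ->
  el k.+1 (fun p : ctx k * nat => J p.1 p.2) ->
  (forall x, F x 0 = G x) -> (forall x n, F x n.+1 = H x n (F x n)) ->
  (forall x n, F x n <= J x n) ->
  el k.+1 (fun p : ctx k * nat => F p.1 p.2).
Proof.
move=> eG eH eJ F0 FS FJ.
by apply: (elementary_brec eG eH eJ) => [x|n x|y] /=.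
Qed.

Lemma el_addn k (F G : ctx k -> nat) :
  el k F -> el k G -> el k (fun x => F x + G x).
Proof.
apply: el_app2.
(* Only [max], successor and [2 ^ x] are at hand to bound the recursion; they suffice, as the sum is
   at most twice the maximum. *)
apply: (@el_brec 1 (fun x => x.2) (fun _ _ u => u.+1) (fun x n => 2 ^ (maxn x.2 n).+1)
  (fun x n => x.2 + n)) => [||||x n|x n].
- exact: el_v0.
- exact/el_succ/el_v1.
- by apply/el_exp2/el_succ/el_maxn; [exact: el_v1|exact: el_v0].
- by move=> x; rewrite addn0.
- by rewrite addnS.
- have := ltn_expl (maxn x.2 n) (isT : 1 < 2); rewrite expnS; lia.
Qed.

Lemma el_muln k (F G : ctx k -> nat) :
  el k F -> el k G -> el k (fun x => F x * G x).
Proof.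
apply: el_app2.
apply: (@el_brec 1 (fun=> 0) (fun x _ u => u + x.2) (fun x n => 2 ^ (x.2 + n))
  (fun x n => x.2 * n)) => [||||x n|x n].
- exact: el_const.
- by apply: el_addn; [exact: el_v1|exact: el_v2].
- by apply/el_exp2/el_addn; [exact: el_v1|exact: el_v0].
- by move=> x; rewrite muln0.
- by rewrite mulnS addnC.
- by rewrite expnD leq_mul // ltnW // ltn_expl.
Qed.

Lemma el_expn k (F G : ctx k -> nat) :
  el k F -> el k G -> el k (fun x => F x ^ G x).
Proof.
apply: el_app2.
apply: (@el_brec 1 (fun=> 1) (fun x _ u => x.2 * u) (fun x n => 2 ^ (x.2 * n))
  (fun x n => x.2 ^ n)) => [||||x n|x n].
- exact: el_const.
- by apply: el_muln; [exact: el_v2|exact: el_v1].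
- by apply/el_exp2/el_muln; [exact: el_v1|exact: el_v0].
- by move=> x; rewrite expn0.
- by rewrite expnS.
- by rewrite expnM; case: n => // n; rewrite leq_exp2r // ltnW // ltn_expl.
Qed.

Lemma el_predn k (F : ctx k -> nat) : el k F -> el k (fun x => (F x).-1).
Proof.
apply: (@el_app1 predn).
apply: (@el_brec 0 (fun=> 0) (fun _ n _ => n) (fun _ n => n) (fun _ n => n.-1)) => //.
- exact: el_const.
- exact: el_v0.
- exact: el_v0.
- by move=> _ n; exact: leq_pred.
Qed.

Lemma el_subn k (F G : ctx k -> nat) :
  el k F -> el k G -> el k (fun x => F x - G x).
Proof.
apply: el_app2.
apply: (@el_brec 1 (fun x => x.2) (fun x _ u => u.-1) (fun x _ => x.2)
  (fun x n => x.2 - n)) => [||||x n|x n].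
- exact: el_v0.
- exact/el_predn/el_v1.
- exact: el_v1.
- by move=> x; rewrite subn0.
- by rewrite subnS.
- exact: leq_subr.
Qed.

Lemma el_leq k (F G : ctx k -> nat) :
  el k F -> el k G -> el k (fun x => F x <= G x).
Proof.
move=> eF eG; rewrite (_ : (fun x => _) = fun x => 1 - (F x - G x)).
  by apply: el_subn; [exact: el_const|exact: el_subn].
by apply: funext => x; case: leqP; lia.
Qed.

Lemma el_negb k (P : ctx k -> bool) :
  el k (fun x => P x) -> el k (fun x => ~~ P x).
Proof.
move=> eP; rewrite (_ : (fun x => _) = fun x => 1 - P x).
  by apply: el_subn => //; exact: el_const.
by apply: funext => x; case: (P x).
Qed.

Lemma el_andb k (P Q : ctx k -> bool) :
  el k (fun x => P x) -> el k (fun x => Q x) -> el k (fun x => P x && Q x).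
Proof.
move=> eP eQ; rewrite (_ : (fun x => _) = fun x => P x * Q x); first exact: el_muln.
by apply: funext => x; rewrite mulnb.
Qed.

Lemma el_eqn k (F G : ctx k -> nat) :
  el k F -> el k G -> el k (fun x => F x == G x).
Proof.
move=> eF eG; under eq_fun do rewrite eqn_leq.
by apply: el_andb; apply: el_leq.
Qed.

Lemma el_if k (P : ctx k -> bool) (F G : ctx k -> nat) :
  el k (fun x => P x) -> el k F -> el k G -> el k (fun x => if P x then F x else G x).
Proof.
move=> eP eF eG; rewrite (_ : (fun x => _) = fun x => P x * F x + ~~ P x * G x).
  by apply: el_addn; apply: el_muln => //; exact: el_negb.
by apply: funext => x; case: (P x); rewrite /=; lia.
Qed.

Lemma el_minn k (F G : ctx k -> nat) :
  el k F -> el k G -> el k (fun x => minn (F x) (G x)).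
Proof. by move=> eF eG; apply: el_if => //; apply: el_leq => //; exact: el_succ. Qed.

(** * Tower bounds, bounded sums, products and quantifiers *)

Lemma leq_tower c m n : m <= n -> iter c (expn 2) m <= iter c (expn 2) n.
Proof. by move=> mn; elim: c => //= c IH; rewrite leq_exp2l. Qed.

Lemma leq_tower_l c d m : c <= d -> iter c (expn 2) m <= iter d (expn 2) m.
Proof.
move=> cd; rewrite -(subnK cd) iterD; elim: (d - c) => //= e IH.
by rewrite (leq_trans IH) // ltnW // ltn_expl.
Qed.

(** Composition adds the height of the outer tower to the largest inner one, and a bounded recursion
    inherits the tower of its bound [J]. Through [el_tower] this provides the bounds for the
    recursions that define sums and products. *)
Lemma elementary_tower k (F : k.-tuple nat -> nat) : elementary F ->
  exists c, forall x, F x <= iter c (expn 2) (\max_(i < k) tnth x i).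
Proof.
have ler n (x : n.-tuple nat) i : tnth x i <= \max_(i < n) tnth x i.
  exact: (leq_bigmax (F := tnth x)).
elim=> {k F} [||||k i|k m G H _ [c Gc] _ IH|k G H J F _ _ _ _ _ [c Jc] _ _ FJ].
- by exists 1 => x /=; rewrite leq_exp2l.
- by exists 0 => x /=; rewrite geq_max !ler.
- by exists 0.
- exists 1 => x; apply: leq_trans (ltn_expl (tnth x ord0) (isT : 1 < 2)) _.
  by rewrite leq_exp2l.
- by exists 0 => x; exact: ler.
- have [d Hd] := choice IH.
  exists (c + \max_(i < m) d i) => x; rewrite iterD (leq_trans (Gc _)) // leq_tower //.
  apply/bigmax_leqP => i _; rewrite tnth_mktuple (leq_trans (Hd i x)) // leq_tower_l //.
  exact: leq_bigmax.
- by exists c => x; exact: leq_trans (FJ x) (Jc x).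
Qed.

Lemma el_tower k (F : ctx k -> nat) : el k F ->
  exists c, forall x, F x <= iter c (expn 2) (ctx_max x).
Proof.
move=> /elementary_tower[c Fc]; exists c => x.
have := Fc (Tuple (size_seq_of_ctx x)); rewrite /= seq_of_ctxK => /leq_trans; apply.
apply/leq_tower/bigmax_leqP => i _.
by rewrite (tnth_nth 0) /= -ctx_nthE leq_ctx_nth.
Qed.

Lemma el_ctx_max k : el k (@ctx_max k).
Proof.
elim: k => [|k IH]; first exact: el_const.
by apply: el_maxn; [exact: el_weak|exact: el_v0].
Qed.

Lemma el_iter_exp2 c k (F : ctx k -> nat) : el k F -> el k (fun x => iter c (expn 2) (F x)).
Proof. by move=> eF; elim: c => //= c IH; exact: el_exp2. Qed.

Lemma el_sum k (B : ctx k -> nat) (F : ctx k -> nat -> nat) :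
  el k B -> el k.+1 (fun p : ctx k * nat => F p.1 p.2) ->
  el k (fun x => \sum_(0 <= i < B x) F x i).
Proof.
move=> eB eF; apply: (@el_subst k (fun x n => \sum_(0 <= i < n) F x i)) => //.
(* One tower of fixed height over max(x, n) bounds every [F x i] with i < n. *)
have [c Fc] := el_tower eF.
apply: (@el_brec k (fun=> 0) (fun x n u => u + F x n)
  (fun x n => n * iter c (expn 2) (maxn (ctx_max x) n))
  (fun x n => \sum_(0 <= i < n) F x i)) => [||||x n|x n].
- exact: el_const.
- by apply: el_addn; [exact: el_v1|exact: el_weak1].
- by apply/el_muln/el_iter_exp2/(@el_ctx_max k.+1); exact: el_v0.
- by move=> x; rewrite big_geq.
- by rewrite big_nat_recr.
- rewrite -[X in X * _]subn0 -sum_nat_const_nat !big_nat leq_sum // => i /andP[_ ltin].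
  by rewrite (leq_trans (Fc (x, i))) // leq_tower //=; lia.
Qed.

Lemma el_prod k (B : ctx k -> nat) (F : ctx k -> nat -> nat) :
  el k B -> el k.+1 (fun p : ctx k * nat => F p.1 p.2) ->
  el k (fun x => \prod_(0 <= i < B x) F x i).
Proof.
move=> eB eF; apply: (@el_subst k (fun x n => \prod_(0 <= i < n) F x i)) => //.
have [c Fc] := el_tower eF.
apply: (@el_brec k (fun=> 1) (fun x n u => u * F x n)
  (fun x n => iter c (expn 2) (maxn (ctx_max x) n) ^ n)
  (fun x n => \prod_(0 <= i < n) F x i)) => [||||x n|x n].
- exact: el_const.
- by apply: el_muln; [exact: el_v1|exact: el_weak1].
- by apply/el_expn/el_v0/el_iter_exp2/(@el_ctx_max k.+1).
- by move=> x; rewrite big_geq.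
- by rewrite big_nat_recr.
- rewrite -[X in _ ^ X]subn0 -prod_nat_const_nat !big_nat leq_prod // => i /andP[_ ltin].
  by rewrite (leq_trans (Fc (x, i))) // leq_tower //=; lia.
Qed.

Lemma el_all k (B : ctx k -> nat) (P : ctx k -> nat -> bool) :
  el k B -> el k.+1 (fun p : ctx k * nat => P p.1 p.2) ->
  el k (fun x => all (P x) (iota 0 (B x))).
Proof.
move=> eB eP.
rewrite (_ : (fun x => _) = fun x => \prod_(0 <= i < B x) P x i); first exact: el_prod.
apply: funext => x; rewrite -[X in iota 0 X]subn0 -/(index_iota 0 (B x)).
by elim: (index_iota _ _) => [|a s IH]; rewrite ?big_nil ?big_cons //= -mulnb IH.
Qed.

Ltac el_step :=
  lazymatch goal with
  | |- el _ (fun _ => ?c) => exact: el_const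
  | |- el _ (fun x => S _) => apply: el_succ
  | |- el _ (fun x => addn _ _) => apply: el_addn
  | |- el _ (fun x => muln _ _) => apply: el_muln
  | |- el _ (fun x => subn _ _) => apply: el_subn
  | |- el _ (fun x => expn _ _) => apply: el_expn
  | |- el _ (fun x => minn _ _) => apply: el_minn
  | |- el _ (fun x => nat_of_bool (leq _ _)) => apply: el_leq
  | |- el _ (fun x => nat_of_bool (eq_op _ _)) => apply: el_eqn
  | |- el _ (fun x => nat_of_bool (negb _)) => apply: el_negb
  | |- el _ (fun x => nat_of_bool (andb _ _)) => apply: el_andb
  | |- el _ (fun x => nat_of_bool (all _ _)) => apply: el_all
  | |- el _ (fun x => if _ then _ else _) => apply: el_if
  | |- el _ (fun x => \sum_(0 <= i < _) _) => apply: el_sum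
  | |- el _ (fun x => \prod_(0 <= i < _) _) => apply: el_prod
  | _ => first [exact: el_v0 | exact: el_v1 | exact: el_v2 | exact: el_v3]
  end.

(** * Counting and searching by sums; division, gcd and primality *)

Lemma sum_ltn m n : \sum_(0 <= i < n) (i < m) = minn m n.
Proof.
elim: n => [|n IH]; first by rewrite big_geq // minn0.
by rewrite big_nat_recr //= IH; case: ltnP; lia.
Qed.

Lemma sum_pick n m (F : nat -> nat) : m < n ->
  \sum_(0 <= i < n) F i * (i == m) = F m.
Proof.
move=> mn; rewrite (bigD1_seq m) ?iota_uniq ?mem_index_iota //= eqxx muln1.
by rewrite big1 ?addn0 // => i /negPf->; rewrite muln0.
Qed.

(** The quotient of a by d counts the i < a with (i + 1) d <= a. The guard 0 < d reproduces the
    default value 0 of division by 0. *)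
Lemma el_divn k (F G : ctx k -> nat) :
  el k F -> el k G -> el k (fun x => F x %/ G x).
Proof.
apply: el_app2.
rewrite (_ : (fun p => _) = fun p : ctx 2 =>
  \sum_(0 <= i < p.1.2) ((0 < p.2) && (i.+1 * p.2 <= p.1.2))); first by repeat el_step.
apply: funext => -[[_ a] d] /=; case: d => [|d].
  by rewrite divn0 big1.
under eq_bigr do rewrite -leq_divRL //.
by rewrite sum_ltn; apply/esym/minn_idPl/leq_div.
Qed.

Lemma el_modn k (F G : ctx k -> nat) :
  el k F -> el k G -> el k (fun x => F x %% G x).
Proof.
move=> eF eG; rewrite (_ : (fun x => _) = fun x => F x - F x %/ G x * G x).
  by el_step => //; el_step => //; exact: el_divn.
by apply: funext => x; rewrite [X in _ = X - _](divn_eq _ (G x)) addKn.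
Qed.

Lemma el_dvdn k (F G : ctx k -> nat) :
  el k F -> el k G -> el k (fun x => F x %| G x).
Proof. by move=> eF eG; apply: el_eqn; [exact: el_modn|exact: el_const]. Qed.

Lemma el_half k (F : ctx k -> nat) : el k F -> el k (fun x => (F x)./2).
Proof. by move=> eF; under eq_fun do rewrite -divn2; apply/el_divn/el_const. Qed.

Lemma el_odd k (F : ctx k -> nat) : el k F -> el k (fun x => odd (F x)).
Proof. by move=> eF; under eq_fun do rewrite -modn2; apply/el_modn/el_const. Qed.

Ltac el_arith :=
  repeat first [el_step | apply: el_dvdn | apply: el_divn | apply: el_half | apply: el_odd].

(** The gcd is the only common divisor that all common divisors divide, and the sum picks it out.
    The search bound a + b, unlike a alone, also covers a = 0, where the gcd is b. *)
Lemma el_gcdn k (F G : ctx k -> nat) :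
  el k F -> el k G -> el k (fun x => gcdn (F x) (G x)).
Proof.
apply: el_app2.
rewrite (_ : (fun p => _) = fun p : ctx 2 =>
  \sum_(0 <= d < (p.1.2 + p.2).+1) d * [&& d %| p.1.2, d %| p.2 &
     all (fun e => ~~ [&& e %| p.1.2, e %| p.2 & ~~ (e %| d)]) (iota 0 (p.1.2 + p.2).+1)]).
  by el_arith.
apply: funext => p; move: p.1.2 p.2 => a b.
have gab : gcdn a b < (a + b).+1.
  case: (posnP a) => [->|a0]; first by rewrite gcd0n.
  by rewrite ltnS (leq_trans (dvdn_leq a0 (dvdn_gcdl a b))) // leq_addr.
rewrite -[LHS](sum_pick id gab); apply: eq_bigr => d _; congr (_ * nat_of_bool _).
rewrite eqn_dvd andbA -dvdn_gcd; congr andb.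
apply/idP/allP => [gd e _|]; last first.
  by move=> /(_ (gcdn a b)); rewrite mem_iota gab dvdn_gcdl dvdn_gcdr negbK => ->.
by rewrite andbA -dvdn_gcd; case: (boolP (e %| gcdn a b)) => //= /dvdn_trans->.
Qed.

Lemma el_prime k (F : ctx k -> nat) : el k F -> el k (fun x => prime (F x)).
Proof.
apply: (@el_app1 (fun n => prime n)).
rewrite (_ : (fun p => _) = fun p : ctx 1 =>
  (1 < p.2) && all (fun d => ~~ ((1 < d) && (d %| p.2))) (iota 0 p.2) : nat); first by el_arith.
apply: funext => p; move: p.2 => n; congr nat_of_bool.
apply/primeP/andP => -[n1 H]; split=> //.
  apply/allP => d; rewrite mem_iota /= => dn.
  by apply/negP => /andP[d1 /H/orP[]/eqP]; lia.
move=> d dn; have := dvdn_leq (ltnW n1) dn; rewrite leq_eqVlt => /orP[->|ltdn].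
  by rewrite orbT.
have /allP/(_ d) := H; rewrite mem_iota /= ltdn dn andbT -leqNgt => /(_ isT).
by case: d dn {ltdn} => [|[|d]] //; rewrite dvd0n; lia.
Qed.

(** * The prime sequence *)

Lemma next_primeP n : [/\ n < next_prime n, prime (next_prime n) &
  forall p, n < p -> prime p -> next_prime n <= p].
Proof.
rewrite /next_prime; case: ex_minnP => m /andP[nm pm] H; split=> // p np pp.
by apply: H; rewrite np.
Qed.

Lemma nth_prime_prime i : prime (nth_prime i).
Proof. by have [] := next_primeP (iter i next_prime 0). Qed.

Lemma nth_prime_gt1 i : 1 < nth_prime i.
Proof. exact/prime_gt1/nth_prime_prime. Qed.

Lemma ltn_nth_prime i : nth_prime i < nth_prime i.+1.
Proof. by have [] := next_primeP (nth_prime i). Qed.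

Lemma leq_nth_prime i j : i <= j -> nth_prime i <= nth_prime j.
Proof. by apply: (homo_leq leqnn leq_trans) => k; exact/ltnW/ltn_nth_prime. Qed.

Lemma nth_prime_surj i p : prime p -> p <= nth_prime i ->
  exists2 j, j <= i & p = nth_prime j.
Proof.
move=> pp; elim: i => [|i IH] le_p.
  exists 0 => //; apply/eqP; rewrite eqn_leq le_p.
  by have [_ _ ->] := next_primeP 0; rewrite ?prime_gt0.
have [/IH[j ji ->]|lt_p] := leqP p (nth_prime i).
  by exists j => //; exact: leqW.
exists i.+1 => //; apply/eqP; rewrite eqn_leq le_p.
by have [_ _ ->] := next_primeP (nth_prime i).
Qed.

(** Euclid's argument: the least prime factor of Q + 1 cannot be one of P_0, ..., P_i, since these
    divide Q. *)
Lemma nth_primeS_leq i : nth_prime i.+1 <= (\prod_(j < i.+1) nth_prime j).+1.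
Proof.
set Q := \prod_(j < i.+1) _.
have Q1 : 1 < Q.+1 by rewrite ltnS prodn_gt0 // => j; rewrite ltnW // nth_prime_gt1.
apply: leq_trans (pdiv_leq (ltnW Q1)).
have [_ _ ->] := next_primeP (nth_prime i); rewrite ?pdiv_prime //.
rewrite ltnNge; apply/negP => /(nth_prime_surj (pdiv_prime Q1))[j ji Ej].
have dQ : pdiv Q.+1 %| Q.
  by rewrite Ej /Q (bigD1 (Ordinal (ji : j < i.+1))) //= dvdn_mulr.
have := pdiv_dvd Q.+1; rewrite -addn1 dvdn_addr ?addn1 // dvdn1 => /eqP E.
by have := pdiv_prime Q1; rewrite E.
Qed.

Lemma nth_prime0 : nth_prime 0 = 2.
Proof.
apply/eqP; rewrite eqn_leq nth_prime_gt1 andbT.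
by have [_ _ ->] := next_primeP 0.
Qed.

(** If Q < u, the next prime is at most Q + 1 <= u, so the next product is below u^2. This leads to
    an elementary bound on [nth_prime]. *)
Lemma primorial_ltn i : \prod_(j < i.+1) nth_prime j < 2 ^ (2 ^ i.+1).
Proof.
elim: i => [|i IH]; first by rewrite big_ord_recl big_ord0 muln1 nth_prime0.
rewrite big_ord_recr /= [2 ^ i.+2]expnS mul2n -addnn expnD.
have := nth_primeS_leq i; move: IH.
by set Q := \prod_(j < _) _; set u := 2 ^ (2 ^ i.+1); nia.
Qed.

Lemma nth_prime_leq_exp2 i : nth_prime i <= 2 ^ (2 ^ i).
Proof.
case: i => [|i]; first by rewrite nth_prime0.
exact: leq_trans (nth_primeS_leq i) (primorial_ltn i).
Qed.

Lemma el_nth_prime k (F : ctx k -> nat) : el k F -> el k (fun x => nth_prime (F x)).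
Proof.
apply: el_app1.
(* The next prime after u equals the number of p such that no prime r satisfies u < r <= p. The
   double exponential bound makes the count finite and bounds the recursion. *)
apply: (@el_brec 0 (fun=> 2) (fun _ n u => \sum_(0 <= p < 2 ^ (2 ^ n.+1))
  all (fun r => ~~ ((u < r) && prime r)) (iota 0 p.+1)) (fun _ n => 2 ^ (2 ^ n))
  (fun _ n => nth_prime n)).
- exact: el_const.
- by repeat first [el_step | apply: el_prime].
- by repeat el_step.
- by move=> _; exact: nth_prime0.
- move=> _ n; rewrite -[LHS](minn_idPl (nth_prime_leq_exp2 n.+1)) -sum_ltn.
  apply: eq_bigr => p _; congr nat_of_bool.
  have [lt_u pr_u min_u] := next_primeP (nth_prime n).
  apply/idP/allP => [ltp r|H].
    rewrite mem_iota /= => rp; apply/negP => /andP[ur /(min_u _ ur)].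
    by rewrite leqNgt (leq_trans _ ltp).
  rewrite ltnNge; apply/negP => le_p.
  by have := H (nth_prime n.+1); rewrite mem_iota /= ltnS le_p lt_u pr_u => /(_ isT).
- by move=> _ n; exact: nth_prime_leq_exp2.
Qed.

(** * Truncations of [g] and [h] *)

(** With E the exponent of the prime in [g j.+1], already 2^E > E exceeds 4 g(j). The factor 4
    passes to [h] in [leq_hS] and serves [sum_h_leq]. *)
Lemma leq_gS j : 4 * g j < g j.+1.
Proof.
rewrite /=; set E := 2 * _ * _.
apply: (@leq_trans (2 ^ E)); last by rewrite leq_exp2r ?nth_prime_gt1 //; rewrite /E; lia.
apply: (@leq_ltn_trans E); last exact: ltn_expl.
by rewrite /E !expnS; nia.
Qed.

Lemma ltn_gS j : g j < g j.+1.
Proof. by have := leq_gS j; lia. Qed.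

Lemma leq_g i j : i <= j -> g i <= g j.
Proof. by apply: (homo_leq leqnn leq_trans) => k; exact/ltnW/ltn_gS. Qed.

Lemma ltn_g j : j < g j.
Proof. by elim: j => // j IH; exact: leq_ltn_trans IH (ltn_gS j). Qed.

Arguments g : simpl never.

(* Capping at [s.+1] gives the recursion for [g] the bound that elementarity needs. *)
Lemma el_g_cap k (F S : ctx k -> nat) :
  el k F -> el k S -> el k (fun x => minn (g (F x)) (S x).+1).
Proof.
move=> eF eS; apply: (el_app2 (f := fun s j => minn (g j) s.+1)) eS eF.
apply: (@el_brec 1 (fun x => minn 1 x.2.+1)
  (fun x j u => if x.2 < u then x.2.+1
     else minn (nth_prime j ^ (2 * (j + 2) * (u + 1) ^ 3)) x.2.+1)
  (fun x _ => x.2.+1) (fun x j => minn (g j) x.2.+1)).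
- by repeat el_step.
- by repeat first [el_step | apply: el_nth_prime].
- by repeat el_step.
- by [].
- move=> -[_ s] j /=; have := ltn_gS j.
  (* Once [g] has passed s the capped value stays at s + 1, because [g] increases; before that the
     capped value is [g j] itself. *)
  case: (leqP (g j) s) => gs; last first.
    by move=> gS; rewrite (minn_idPr gs) ltnSn; apply/minn_idPr/(ltn_trans gs).
  by move=> _; rewrite (minn_idPl (leqW gs)) ltnNge gs.
- by move=> x n; exact: geq_minr.
Qed.

Section Honest.

Variable f : nat -> nat.
Hypothesis hf : honest f.

Lemma el_honest_graph k (F G : ctx k -> nat) :
  el k F -> el k G -> el k (fun x => f (F x) == G x).
Proof.
move=> eF eG; apply: (el_app2 (f := fun b a => f a == b)) eG eF.
case: hf => _ _; congr elementary; apply: funext => x.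
by rewrite ctx_of_tuple2.
Qed.

(** Honesty makes only the graph of [f] elementary. The capped value is the number of y <= s with y
    < f(i), and y < f(i) says that the graph holds for no z <= y. *)
Lemma el_honest_cap k (F S : ctx k -> nat) :
  el k F -> el k S -> el k (fun x => minn (f (F x)) (S x).+1).
Proof.
apply: (@el_app2 (fun i s => minn (f i) s.+1)).
rewrite (_ : (fun p => _) = fun p : ctx 2 => \sum_(0 <= y < p.2.+1)
  all (fun z => ~~ (f p.1.2 == z)) (iota 0 y.+1)).
  by repeat first [apply: el_honest_graph | el_step].
apply: funext => p; move: p.1.2 p.2 => i s; rewrite -sum_ltn; apply: eq_bigr => y _.
congr nat_of_bool; apply/idP/allP => [yf z|H].
  by rewrite mem_iota /=; lia.
rewrite ltnNge; apply/negP => fy.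
by have := H (f i); rewrite mem_iota /= ltnS fy eqxx => /(_ isT).
Qed.

(** If f(i) > s, both sides equal s + 1 because g(j) > j. *)
Lemma h_capE i s : minn (h f i) s.+1 = minn (g (minn (f i) s.+1 + i)) s.+1.
Proof.
rewrite /h; have [fs|sf] := leqP (f i) s; first by rewrite (minn_idPl (leqW fs)).
rewrite (minn_idPr sf); have := ltn_g (f i + i); have := ltn_g (s.+1 + i); lia.
Qed.

Lemma el_h_cap k (F S : ctx k -> nat) :
  el k F -> el k S -> el k (fun x => minn (h f (F x)) (S x).+1).
Proof.
move=> eF eS; under eq_fun do rewrite h_capE.
by apply: el_g_cap => //; apply: el_addn => //; exact: el_honest_cap.
Qed.

Lemma leq_hS i : 4 * h f i < h f i.+1.
Proof.
case: hf => f_mono _ _; apply: leq_trans (leq_gS _) _.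
by rewrite /h leq_g // addnS ltnS leq_add2r.
Qed.

Lemma ltn_h i : i < h f i.
Proof. by apply: leq_ltn_trans (ltn_g _); exact: leq_addl. Qed.

Lemma leq_h i j : i <= j -> h f i <= h f j.
Proof.
by apply: (homo_leq leqnn leq_trans) => k; have := leq_hS k; lia.
Qed.

(** The range i < s loses no index with h(i) <= s, since i < h(i). *)
Definition trunc_den (s : nat) : nat := \prod_(0 <= i < s | h f i <= s) nth_prime i ^ h f i.

(** Every division here is exact, by [dvdn_trunc_den]. *)
Definition trunc_num (s : nat) : nat :=
  \sum_(0 <= i < s | h f i <= s) trunc_den s %/ nth_prime i ^ h f i.

Lemma leq_cap (m s : nat) : (m <= s) = (minn m s.+1 <= s).
Proof. by rewrite geq_min ltnn orbF. Qed.

Lemma el_trunc_den k (S : ctx k -> nat) : el k S -> el k (fun x => trunc_den (S x)).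
Proof.
apply: el_app1.
rewrite (_ : (fun p => _) = fun p : ctx 1 => \prod_(0 <= i < p.2)
  if minn (h f i) p.2.+1 <= p.2 then nth_prime i ^ minn (h f i) p.2.+1 else 1).
  by repeat first [apply: el_h_cap | apply: el_nth_prime | el_step].
apply: funext => -[_ s] /=; rewrite /trunc_den big_mkcond; apply: eq_bigr => i _.
by rewrite -leq_cap; case: leqP => // hs; rewrite (minn_idPl (leqW hs)).
Qed.

Lemma el_trunc_num k (S : ctx k -> nat) : el k S -> el k (fun x => trunc_num (S x)).
Proof.
apply: el_app1.
rewrite (_ : (fun p => _) = fun p : ctx 1 => \sum_(0 <= i < p.2)
  if minn (h f i) p.2.+1 <= p.2 then trunc_den p.2 %/ nth_prime i ^ minn (h f i) p.2.+1 else 0).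
  by repeat first [apply: el_h_cap | apply: el_nth_prime | el_step | apply: el_divn
    | apply: el_trunc_den].
apply: funext => -[_ s] /=; rewrite /trunc_num big_mkcond; apply: eq_bigr => i _.
by rewrite -leq_cap; case: leqP => // hs; rewrite (minn_idPl (leqW hs)).
Qed.

End Honest.

(** * Coded rationals *)

Lemma el_cantor_pair k (F G : ctx k -> nat) :
  el k F -> el k G -> el k (fun x => cantor_pair (F x) (G x)).
Proof. by apply: el_app2; rewrite /cantor_pair; el_arith. Qed.

Lemma leq_cantor_pair a b : a + b <= cantor_pair a b.
Proof.
rewrite /cantor_pair; set m := a + b.
have : m.*2 <= m * m.+1 by case: m => // m; rewrite -muln2; nia.
have [->|m0] := posnP m; first by [].
by move=> /half_leq; rewrite doubleK; lia.
Qed.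

Lemma eq_cantor_pair a b c d :
  (cantor_pair a b == cantor_pair c d) = (a == c) && (b == d).
Proof. by apply/eqP/andP => [/cantor_pair_inj[-> ->]|[/eqP-> /eqP->]]. Qed.

(** A bounded search written as a sum: injectivity leaves at most one contributing pair, and
    [leq_cantor_pair] keeps it within the bounds. *)
Definition cantor_fst (e : nat) : nat :=
  \sum_(0 <= a < e.+1) \sum_(0 <= b < e.+1) a * (cantor_pair a b == e).

Definition cantor_snd (e : nat) : nat :=
  \sum_(0 <= b < e.+1) \sum_(0 <= a < e.+1) b * (cantor_pair a b == e).

Lemma cantor_fstK a b : cantor_fst (cantor_pair a b) = a.
Proof.
rewrite /cantor_fst; set e := cantor_pair a b; have le_e := leq_cantor_pair a b.
rewrite -[RHS](@sum_pick e.+1 a id) ?ltnS; last by rewrite /e; lia.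
apply: eq_bigr => i _.
rewrite -[RHS](@sum_pick e.+1 b (fun=> i * (i == a))) ?ltnS; last by rewrite /e; lia.
by apply: eq_bigr => j _; rewrite eq_cantor_pair -mulnb mulnA.
Qed.

Lemma cantor_sndK a b : cantor_snd (cantor_pair a b) = b.
Proof.
rewrite /cantor_snd; set e := cantor_pair a b; have le_e := leq_cantor_pair a b.
rewrite -[RHS](@sum_pick e.+1 b id) ?ltnS; last by rewrite /e; lia.
apply: eq_bigr => j _.
rewrite -[RHS](@sum_pick e.+1 a (fun=> j * (j == b))) ?ltnS; last by rewrite /e; lia.
by apply: eq_bigr => i _; rewrite eq_cantor_pair andbC -mulnb mulnA.
Qed.

Lemma el_cantor_fst k (F : ctx k -> nat) : el k F -> el k (fun x => cantor_fst (F x)).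
Proof.
by apply: el_app1; rewrite /cantor_fst; repeat first [el_step | apply: el_cantor_pair].
Qed.

Lemma el_cantor_snd k (F : ctx k -> nat) : el k F -> el k (fun x => cantor_snd (F x)).
Proof.
by apply: el_app1; rewrite /cantor_snd; repeat first [el_step | apply: el_cantor_pair].
Qed.

(** Dividing by the gcd puts u / v in lowest terms; doubling is [int_code] on nonnegative
    integers. *)
Definition fraction_code (u v : nat) : nat :=
  cantor_pair (u %/ gcdn u v).*2 (v %/ gcdn u v).

Lemma el_fraction_code k (F G : ctx k -> nat) :
  el k F -> el k G -> el k (fun x => fraction_code (F x) (G x)).
Proof.
apply: el_app2; rewrite /fraction_code; under eq_fun do rewrite -muln2.
by repeat first [el_step | apply: el_cantor_pair | apply: el_divn | apply: el_gcdn].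
Qed.

Lemma rat_code_fraction (u v : nat) : 0 < v ->
  rat_code (u%:R / v%:R)%R = fraction_code u v.
Proof.
move=> v0; rewrite /rat_code /fraction_code.
set d := gcdn u v; set u' := u %/ d; set v' := v %/ d.
have d0 : 0 < d by rewrite gcdn_gt0 v0 orbT.
have uE : u = u' * d by rewrite divnK // dvdn_gcdl.
have vE : v = v' * d by rewrite divnK // dvdn_gcdr.
have v'0 : 0 < v' by move: v0; rewrite vE muln_gt0 => /andP[].
have co : coprime `|Posz u'| `|Posz v'|.
  by rewrite /= /coprime -(eqn_pmul2r d0) muln_gcdl -uE -vE mul1n.
have -> : (u%:R / v%:R = (Posz u')%:~R / (Posz v')%:~R :> rat)%R.
  rewrite uE vE !natrM -mulf_div divff ?mulr1 //.
  by rewrite pnatr_eq0 -lt0n.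
rewrite coprimeq_num // coprimeq_den // gtr0_sg // mul1r.
by case: (v') v'0.
Qed.

(** * The trace function on codes, and the size of the truncated denominator *)

Section TraceFunction.

Variable f : nat -> nat.
Hypothesis hf : honest f.

Definition precision (n : nat) : nat := n.*2 + 4.

(** Here a codes the numerator of q, so it is odd exactly when q < 0; n is the denominator; and 2 is
    the code of 0 = 0/1. The last branch is (A + q)/2 over the common denominator 2Dn. *)
Definition upper_code (a n : nat) : nat :=
  let s := precision n in
  if odd a then 2
  else if a./2 * trunc_den f s <= trunc_num f s * n then 2
  else fraction_code (trunc_num f s * n + a./2 * trunc_den f s) (2 * trunc_den f s * n).

Lemma el_upper_code k (F G : ctx k -> nat) :
  el k F -> el k G -> el k (fun x => upper_code (F x) (G x)).
Proof.
apply: el_app2; rewrite /upper_code /precision /=; under eq_fun do rewrite -muln2.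
by repeat first [el_step | apply: (el_trunc_den hf) | apply: (el_trunc_num hf)
  | apply: el_fraction_code | apply: el_half | apply: el_odd].
Qed.

(** As [h] is nondecreasing, selecting terms by the size of h(i) is the same as cutting at the least
    c with h(c) > s; c <= s because h(s) > s. *)
Lemma ex_cutoff s : exists2 c, c <= s & forall i, (h f i <= s) = (i < c).
Proof.
have ex : exists i, s < h f i by exists s; exact: ltn_h.
case: (ex_minnP ex) => c sc minc; exists c; first exact/minc/ltn_h.
move=> i; apply/idP/idP => [his|ic].
  by rewrite ltnNge; apply/negP => /(leq_h hf); lia.
by rewrite leqNgt; apply/negP => /minc; lia.
Qed.

Lemma trunc_den_gt0 s : 0 < trunc_den f s.
Proof. by rewrite prodn_cond_gt0 // => i _; rewrite expn_gt0 ltnW // nth_prime_gt1. Qed.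

Lemma dvdn_trunc_den s i : i < s -> h f i <= s -> nth_prime i ^ h f i %| trunc_den f s.
Proof.
by move=> ltis his; rewrite /trunc_den (big_rem i) ?mem_index_iota //= his dvdn_mulr.
Qed.

(** Half of the exponent h(c) thus outweighs the denominator D, and the other half remains to
    outweigh 4n in [trunc_den_ltn]. *)
Lemma sum_h_leq c : 2 * \sum_(i < c) h f i <= h f c.
Proof.
elim: c => [|c IH]; first by rewrite big_ord0.
rewrite big_ord_recr /= mulnDr; apply: leq_trans (ltnW (leq_hS hf c)).
by rewrite (mulnDl 2 2) leq_add // (leq_trans IH) // leq_pmull.
Qed.

Lemma big_cutoff (T : Type) (idx : T) (op : T -> T -> T) (a : nat -> T) s c :
  c <= s -> (forall i, (h f i <= s) = (i < c)) ->
  \big[op/idx]_(0 <= i < s | h f i <= s) a i = \big[op/idx]_(i < c) a i.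
Proof.
move=> cs cut; rewrite -(big_mkord xpredT) [RHS](big_nat_widen _ _ _ _ _ cs).
by apply: eq_bigl => i; rewrite cut.
Qed.

Lemma trunc_den_ltn n c : c <= precision n -> (forall i, (h f i <= precision n) = (i < c)) ->
  4 * n * trunc_den f (precision n) < nth_prime c ^ h f c.
Proof.
move=> cs cut; rewrite /trunc_den (big_cutoff _ _ _ cs cut).
have hc : precision n < h f c by rewrite ltnNge cut ltnn.
have sum_h := sum_h_leq c.
set S := \sum_(i < c) h f i in sum_h.
have denS : \prod_(i < c) nth_prime i ^ h f i <= nth_prime c ^ S.
  rewrite /S expn_sum; apply: leq_prod => i _.
  by rewrite leq_exp2r ?(leq_ltn_trans _ (ltn_h _ _)) // leq_nth_prime // ltnW.
have p1 := nth_prime_gt1 c.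
rewrite -(subnKC (_ : S <= h f c)); last by lia.
rewrite expnD mulnC.
(* By the choice of [precision], h(c) >= 2n + 5, and S is at most h(c)/2, so the exponent is at
   least n + 3; and 2^(n + 3) = 8 2^n > 4n. *)
have lt4n : 4 * n < nth_prime c ^ (h f c - S).
  apply: (@leq_trans (2 ^ (n + 3))).
    by rewrite expnD; have := ltn_expl n (isT : 1 < 2); lia.
  apply: (@leq_trans (nth_prime c ^ (n + 3))); first by rewrite leq_exp2r // addn3.
  by rewrite leq_exp2l //; move: hc; rewrite /precision; lia.
apply: (@leq_ltn_trans (nth_prime c ^ S * (4 * n))); first by rewrite leq_mul2r denS orbT.
by rewrite ltn_pmul2l // expn_gt0 ltnW.
Qed.

(** * Estimates for the partial sums and their limit *)

Local Open Scope ring_scope.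

Definition term (F : numFieldType) (i : nat) : F := (nth_prime i)%:R ^- h f i.

Lemma term_gt0 (F : numFieldType) i : 0 < term F i.
Proof. by rewrite invr_gt0 exprn_gt0 // ltr0n ltnW // nth_prime_gt1. Qed.

Lemma trunc_sumE (F : numFieldType) s c :
  (c <= s)%N -> (forall i, (h f i <= s)%N = (i < c)%N) ->
  (trunc_num f s)%:R / (trunc_den f s)%:R = \sum_(i < c) term F i.
Proof.
move=> cs cut; rewrite -(big_cutoff _ _ _ cs cut) natr_sum mulr_suml.
rewrite [LHS]big_nat_cond [RHS]big_nat_cond; apply: eq_bigr => i /andP[/andP[_ ltis] his].
have D0 := trunc_den_gt0 s.
rewrite -[X in _ / X%:R](divnK (dvdn_trunc_den ltis his)) natrM invfM mulrA divff ?mul1r ?natrX //.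
rewrite pnatr_eq0 -lt0n divn_gt0 ?(dvdn_leq _ (dvdn_trunc_den _ _)) //.
by rewrite expn_gt0 ltnW // nth_prime_gt1.
Qed.

(** Since h(c + m) >= h(c) + m, the power of P_(c+m) splits into one of exponent h(c), at least
    P_c^h(c), and one of exponent m, at least 2^m. *)
Lemma term_geometric (F : numFieldType) c m : term F (c + m) <= term F c / 2 ^+ m.
Proof.
rewrite -invfM lef_pV2 ?posrE ?mulr_gt0 ?exprn_gt0 ?ltr0n ?(ltnW (nth_prime_gt1 _)) //.
rewrite -!natrX -natrM ler_nat.
have hm : (h f c + m <= h f (c + m))%N.
  by elim: m => [|m IH]; rewrite ?addn0 // !addnS; have := leq_hS hf (c + m); lia.
apply: leq_trans (_ : nth_prime (c + m) ^ (h f c + m) <= _)%N; last first.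
  by rewrite leq_exp2l ?nth_prime_gt1.
rewrite expnD leq_mul //.
  by rewrite leq_exp2r ?(leq_ltn_trans _ (ltn_h _ _)) // leq_nth_prime // leq_addr.
by case: m {hm} => // m; rewrite leq_exp2r // nth_prime_gt1.
Qed.

(** The extra summand on the left is what remains of the geometric series; each new term uses at
    most half of it, which is what the induction requires. *)
Lemma sum_term_tail (F : numFieldType) c m :
  \sum_(i < c + m) term F i + 2 * term F c / 2 ^+ m <= \sum_(i < c) term F i + 2 * term F c.
Proof.
elim: m => [|m]; first by rewrite addn0 expr0 divr1.
apply: le_trans; rewrite addnS big_ord_recr /= -addrA lerD2l.
have -> : 2 * term F c / 2 ^+ m.+1 = term F c / 2 ^+ m.
  by rewrite exprS invfM mulrACA divff ?mul1r // pnatr_eq0.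
by rewrite -mulrA mulr_natl mulr2n lerD2r term_geometric.
Qed.

Lemma sum_term_homo (F : numFieldType) :
  {homo (fun n => \sum_(i < n) term F i) : m n / (m <= n)%N >-> m <= n}.
Proof.
apply: (homo_leq le_refl (fun y x z => @le_trans _ _ y x z)) => n.
by rewrite big_ord_recr /= lerDl ltW // term_gt0.
Qed.

Lemma alpha_bounds (R : realType) c :
  \sum_(i < c) term R i <= alpha R f <= \sum_(i < c) term R i + 2 * term R c.
Proof.
have ndu : nondecreasing_seq (alpha_approx R f).
  by move=> m n mn; exact: (@sum_term_homo R m.+1 n.+1).
have ub n : alpha_approx R f n <= \sum_(i < c) term R i + 2 * term R c.
  (* [alpha_approx R f n] has n + 1 terms, all among the first c + (n + 1). *)
  apply: le_trans (sum_term_homo R (leq_addl c n.+1)) _.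
  apply: le_trans (sum_term_tail R c n.+1); rewrite lerDl.
  by rewrite divr_ge0 ?mulr_ge0 ?exprn_ge0 // ltW // term_gt0.
have cvu : cvgn (alpha_approx R f).
  by apply: nondecreasing_is_cvgn => //; eexists => _ [n _ <-]; exact: ub.
apply/andP; split.
  apply: le_trans (nondecreasing_cvgn_le ndu cvu c).
  exact: (sum_term_homo R (leqnSn c)).
by apply: limr_le => //; near=> n; exact: ub.
Unshelve. all: by end_near. Qed.

(** * The trace function on rationals *)

Definition upper (q : rat) : rat :=
  let s := precision `|denq q| in
  let A := (trunc_num f s)%:R / (trunc_den f s)%:R in
  if q <= A then 0 else (A + q) / 2.

Lemma upper_codeE q :
  upper_code (cantor_fst (rat_code q)) (cantor_snd (rat_code q)) = rat_code (upper q).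
Proof.
rewrite /rat_code cantor_fstK cantor_sndK -/(rat_code (upper q)) /upper_code /upper.
set n := `|denq q|%N; set s := precision n; set A := _ / _.
have n0 : (0 < n)%N by rewrite absz_gt0 denq_neq0.
have D0 := trunc_den_gt0 s.
have nR : (0 : rat) < n%:R by rewrite ltr0n.
have DR : (0 : rat) < (trunc_den f s)%:R by rewrite ltr0n.
have qE : q = (numq q)%:~R / n%:R by rewrite -[LHS]divq_num_den -[in LHS](absz_denq q).
case: (numq q) qE => m qE /=; last first.
  (* A negative q satisfies q <= A because A >= 0, so both definitions return 0. *)
  rewrite odd_double /= (le_trans _ (_ : 0 <= A)) //; last by rewrite divr_ge0.
  by rewrite qE pmulr_lle0 ?invr_gt0 // lerz0.
rewrite odd_double doubleK.
have -> : (q <= A) = (m * trunc_den f s <= trunc_num f s * n)%N.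
  by rewrite qE ler_pdivrMr // mulrAC ler_pdivlMr // -!natrM ler_nat.
case: ifP => // _; rewrite -rat_code_fraction ?muln_gt0 ?D0 //.
congr rat_code; rewrite qE /A natrD !natrM -[m%:~R]/(m%:R).
by field; rewrite !gt_eqF.
Qed.

Lemma elementary_upper : elementary_ratfun upper.
Proof.
pose t (x : ctx 1) := upper_code (cantor_fst x.2) (cantor_snd x.2).
exists (fun x => t (ctx_of_seq 1 x)); split; last by move=> q; rewrite -upper_codeE.
suff : el 1 t by [].
by apply: el_upper_code; [apply: el_cantor_fst|apply: el_cantor_snd]; exact: el_v0.
Qed.

(** The alternatives are the cases q <= A and q > A. Each strict hypothesis of the theorem rules out
    one of them. *)
Lemma upper_spec (R : realType) q :
  (upper q = 0 /\ ratr q <= alpha R f) \/ (upper q < q /\ alpha R f < ratr (upper q)).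
Proof.
rewrite /upper; set n := `|denq q|%N; set s := precision n; set A := _ / _.
have [c cs cut] := ex_cutoff s.
have AE : ratr A = \sum_(i < c) term R i.
  by rewrite fmorph_div /= !ratr_nat (trunc_sumE _ cs cut).
have /andP[leA geA] := alpha_bounds R c; rewrite -AE in leA geA.
have [qA|Aq] := leP q A; [left|right].
  by split=> //; apply: le_trans leA; rewrite ler_rat.
split; first by rewrite ltr_pdivrMr //; lra.
apply: le_lt_trans geA _.
have n0 : (0 < n)%N by rewrite absz_gt0 denq_neq0.
have D0 := trunc_den_gt0 s.
(* q - A is an integer over nD, and this integer is positive, hence at least 1. *)
have gap : (n * trunc_den f s)%:R^-1 <= q - A.
  have nR : (0 : rat) < n%:R by rewrite ltr0n.
  have DR : (0 : rat) < (trunc_den f s)%:R by rewrite ltr0n.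
  have qE : q = (numq q)%:~R / n%:R by rewrite -[LHS]divq_num_den -[in LHS](absz_denq q).
  have E : q - A = (numq q * Posz (trunc_den f s) - Posz (trunc_num f s * n))%:~R / (n * trunc_den f s)%:R.
    rewrite [in LHS]qE /A rmorphB rmorphM /= -!pmulrn !natrM.
    by field; rewrite !gt_eqF.
  move: Aq; rewrite -subr_gt0 E pmulr_lgt0 ?invr_gt0 ?ltr0n ?muln_gt0 ?n0 // ltr0z => z0.
  by rewrite -[leLHS]mul1r ler_pM2r ?invr_gt0 ?ltr0n ?muln_gt0 ?n0 // (ler_int _ 1).
(* So the tail bound 2 P_c^(-h(c)) is less than half of q - A, which places alpha below the midpoint
   of A and q. *)
have tail : 4 * term R c < (n * trunc_den f s)%:R^-1.
  have := trunc_den_ltn cs cut; rewrite -/s -(ltr_nat R) !natrM natrX => lt_den.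
  rewrite -ltr_pdivlMl // -invfM mulrA ltf_pV2 ?posrE //.
    by rewrite exprn_gt0 // ltr0n ltnW // nth_prime_gt1.
  by rewrite !mulr_gt0 ?ltr0n.
have : ratr ((n * trunc_den f s)%:R^-1) <= ratr (q - A) :> R by rewrite ler_rat.
rewrite fmorphV /= ratr_nat rmorphB /= [ratr ((_ + _) / _)]fmorph_div /= rmorphD /= ratr_nat; lra.
Qed.

End TraceFunction.

Local Open Scope ring_scope.

Theorem theorem3 (R : realType) (f : nat -> nat) (hf : honest f) :
  exists T : rat -> rat,
    elementary_ratfun T /\
    (forall q : rat, ratr q < alpha R f -> T q = 0) /\
    (forall q : rat, alpha R f < ratr q -> T q < q /\ alpha R f < ratr (T q)).
Proof.
exists (upper f); split; first exact: elementary_upper.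
split=> q hq; have [[T0 le_q]|[Tq lt_T]] := upper_spec hf R q => //.
  (* For q < alpha the second alternative would give q < alpha < [upper f q] < q. *)
  by have := lt_trans hq lt_T; rewrite ltr_rat ltNge ltW.
by move: hq; rewrite ltNge le_q.
Qed.
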